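(* Given a chain $\mathcal{T} \subseteq \mathcal{F}$, there exists a map $\phi : \mathcal{T}_* \cap \mathcal{F} \rightarrow \mathcal{F}$ such that: 1. for all $A \in \mathcal{T}_* \cap \mathcal{F}$, $\phi(A) \triangle A \in \mathcal{N}$; 2. for all $A, B \in \mathcal{T}_* \cap \mathcal{F}$, $[A] = [B] \iff \phi(A) = \phi(B)$, and $[A] < [B] \iff \phi(A) \subsetneq \phi(B)$; 3. for all $\mathcal{S} \subseteq \mathcal{T}_* \cap \mathcal{F}$, (a) $\bigcup \phi(\mathcal{S}) \in \mathcal{F}$ with $\nu(\bigcup \phi(\mathcal{S})) = \sup \{ \nu(A) : A \in \phi(\mathcal{S}) \}$, and (b) $\bigcap \phi(\mathcal{S}) \in \mathcal{F}$ with $\nu(\bigcap \phi(\mathcal{S})) = \inf \{ \nu(A) : A \in \phi(\mathcal{S}) \}$; 4. for all $A \in \phi(\mathcal{T}_* \cap \mathcal{F})_*$ and $N \in \mathbb{N}$, $\nu_N(A) \leq \nu(A)$; 5. if there exists a second map $\rho : \mathcal{T}_* \cap \mathcal{F} \rightarrow \mathcal{F}$ such that $\rho(A) \triangle A \in \mathcal{N}$ for all $A \in \mathcal{T}_* \cap \mathcal{F}$, then for all $\mathcal{S} \subseteq \mathcal{T}_* \cap \mathcal{F}$, (a) if $\bigcup \rho(\mathcal{S}) \in \mathcal{F}$ with $\nu(\bigcup \rho(\mathcal{S})) = \sup \{ \nu(A) : A \in \rho(\mathcal{S}) \}$, then $\left( \bigcup \phi(\mathcal{S}) \right) \triangle \left(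 \bigcup \rho(\mathcal{S}) \right) \in \mathcal{N}$, and (b) if $\bigcap \rho(\mathcal{S}) \in \mathcal{F}$ with $\nu(\bigcap \rho(\mathcal{S})) = \inf \{ \nu(A) : A \in \rho(\mathcal{S}) \}$, then $\left( \bigcap \phi(\mathcal{S}) \right) \triangle \left( \bigcap \rho(\mathcal{S}) \right) \in \mathcal{N}$.
   Context: $\mathbb{N} = \{1,2,3,\ldots\}$ and $\mathcal{P}(\mathbb{N})$ is its power set. For $A \subseteq \mathbb{N}$ and $N \in \mathbb{N}$, $\nu_N(A) := \frac{1}{N}\sum_{n=1}^N I_A(n)$, where $I_A$ is the indicator function of $A$. $\mathcal{F}$ is the collection of all $A \subseteq \mathbb{N}$ for which $\lim_{N\to\infty}\nu_N(A)$ exists, and for $A\in\mathcal{F}$, $\nu(A)$ denotes this limit. $\mathcal{N} := \{A\in\mathcal{F} : \nu(A)=0\}$, an ideal of the Boolean algebra $\mathcal{P}(\mathbb{N})$. For $A\subseteq\mathbb{N}$, $[A]$ is the class of $A$ in the quotient Boolean algebra $\mathcal{P}(\mathbb{N})/\mathcal{N}$, i.e. under $A\sim B\iff A\triangle B\in\mathcal{N}$; the partial order is $[A]\leq[B]\iff A\setminus B\in\mathcal{N}$, and $[A]<[B]$ means $[A]\leq[B]$ and $[A]\neq[B]$. A chain is a collection of sets totally ordered by inclusion. For a chain $\mathcal{T} \subseteq \mathcal{P}(\mathbb{N})$, $\mathcal{T}_{\cup} := \{\bigcup \mathcal{C} : \mathcal{C}\subseteq\mathcal{T}\}$, $\mathcal{T}_{\cap}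 := \{\bigcap \mathcal{C} : \mathcal{C}\subseteq\mathcal{T}\}$ and $\mathcal{T}_* := \mathcal{T}_{\cup}\cup\mathcal{T}_{\cap}$. For a map $\phi$ and a subcollection $\mathcal{S}$ of its domain, $\phi(\mathcal{S}) := \{\phi(A) : A\in\mathcal{S}\}$. Conventions for the empty subcollection: $\bigcup\emptyset=\emptyset$, $\bigcap\emptyset=\mathbb{N}$, and suprema and infima are taken in $[0,1]$, so $\sup\emptyset = 0$ and $\inf\emptyset=1$. *)

(* Defs.v *)
From mathcomp Require Import all_boot all_order all_algebra.
From mathcomp Require Import all_classical all_reals all_analysis.

Set Implicit Arguments.
Unset Strict Implicit.
Unset Printing Implicit Defensive.

Import Order.TTheory GRing.Theory Num.Theory.
Import numFieldNormedType.Exports.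

Local Open Scope classical_set_scope.
Local Open Scope ring_scope.

(* N = {1, 2, 3, ...} *)
Definition posnat : Type := {n : nat | (0 < n)%N}.

Definition succ_pos (i : nat) : posnat := exist _ i.+1 (ltn0Sn i).

Section Density.
Variable R : realType.
Implicit Types (A B : set posnat) (E : set R).

(* The index i < N stands for the integer n = i + 1 of {1, ..., N}. The junk
   value at N = 0 is 0; it has no effect on limits as N tends to infinity. *)
Definition nuN A (N : nat) : R :=
  N%:R^-1 * \sum_(i < N) \1_A (succ_pos i).

Definition has_density : set (set posnat) :=
  [set A | cvg (nuN A N @[N --> \oo])].

Definition density A : R := lim (nuN A N @[N --> \oo]).

Definition null_sets : set (set posnat) :=
  [set A | has_density A /\ density A = 0].

(* The class [A] in the quotient of the power set by null_sets. *)
Definition dclass A : set (set posnat) := [set B | null_sets (A `+` B)].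

(* The order of the quotient, as a relation between classes; dclass_leP shows
   that it does not depend on the representatives. *)
Definition dclass_le (a b : set (set posnat)) : Prop :=
  exists A B, [/\ a = dclass A, b = dclass B & null_sets (A `\` B)].

Definition dclass_lt (a b : set (set posnat)) : Prop :=
  dclass_le a b /\ a <> b.

(* Supremum and infimum in the ordered set [0, 1], for E a subset of [0, 1]:
   they differ from those of R only in their values at the empty set. *)
Definition sup01 E : R := if `[< E = set0 >] then 0 else sup E.
Definition inf01 E : R := if `[< E = set0 >] then 1 else inf E.

Lemma nuN_ge0 A N : 0 <= nuN A N.
Proof.
by rewrite mulr_ge0 ?invr_ge0 ?ler0n ?sumr_ge0// => i _; rewrite indicE ler0n.
Qed.

Lemma null_setsE A : null_sets A <-> nuN A N @[N --> \oo] --> (0 : R).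
Proof.
split=> [[cA dA]|cA]; first by rewrite -dA; exact: cA.
by split; [apply: cvgP cA | apply: cvg_lim cA].
Qed.

Lemma null_sets_subU A B C : C `<=` A `|` B ->
  null_sets A -> null_sets B -> null_sets C.
Proof.
move=> CAB /null_setsE cA /null_setsE cB; apply/null_setsE.
have cAB : nuN A N + nuN B N @[N --> \oo] --> (0 : R).
  by rewrite -[X in _ --> X](addr0 0); exact: cvgD.
apply: (squeeze_cvgr _ (cvg_cst 0) cAB); apply: nearW => N.
rewrite nuN_ge0/= -mulrDr ler_wpM2l ?invr_ge0 ?ler0n// -big_split/=.
apply: ler_sum => i _; rewrite !indicE -natrD ler_nat.
case: (boolP (_ \in C)) => //; rewrite inE => /CAB[] h.
  by rewrite [_ \in A]mem_set.
by rewrite [_ \in B]mem_set// addn1.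
Qed.

Lemma null_sets0 : null_sets set0.
Proof.
apply/null_setsE; rewrite (_ : nuN set0 = fun=> 0); first exact: cvg_cst.
by apply/funext => N; rewrite /nuN big1 ?mulr0// => i _; rewrite indicE in_set0.
Qed.

Lemma dclass_eqP A B : dclass A = dclass B <-> null_sets (A `+` B).
Proof.
split=> [AB|AB].
  have : dclass B B.
    by apply: null_sets_subU null_sets0 null_sets0 => n /=; tauto.
  by rewrite -AB.
apply/seteqP; split=> C /= hC; apply: null_sets_subU AB hC => n /=;
  have := EM (A n); have := EM (B n); tauto.
Qed.

Lemma dclass_leP A B : dclass_le (dclass A) (dclass B) <-> null_sets (A `\` B).
Proof.
split=> [[A' [B' [/dclass_eqP AA' /dclass_eqP BB' A'B']]]|AB]; last first.
  by exists A, B.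
have AB' : null_sets (A `\` B').
  by apply: null_sets_subU AA' A'B' => n /=; have := EM (A' n); tauto.
by apply: null_sets_subU BB' AB' => n /=; have := EM (B' n); tauto.
Qed.

End Density.

Section Chains.
Variable T : Type.
Implicit Type F : set (set T).

Definition chain F : Prop := total_on F (@subset T).

Definition cup_closure F : set (set T) :=
  [set \bigcup_(A in C) A | C in [set C | C `<=` F]].

(* For C = set0 the intersection is setT. *)
Definition cap_closure F : set (set T) :=
  [set \bigcap_(A in C) A | C in [set C | C `<=` F]].

Definition star F : set (set T) := cup_closure F `|` cap_closure F.

End Chains.

(* Main.v *)
Require Import Defs.
From mathcomp Require Import all_boot all_order all_algebra.
From mathcomp Require Import all_classical all_reals all_analysis.
From mathcomp Require Import ring lra.
Import Order.TTheory GRing.Theory Num.Theory.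
Import numFieldNormedType.Exports.
Local Open Scope classical_set_scope.
Local Open Scope ring_scope.

(** Within the chain D of members of [star T] that have a density, a set is
    determined up to a null set by its density. So phi may be sought in the form
    A |-> P (nu A), where P v, for v >= 0, is a family of sets, increasing in v,
    such that
    - P v has at most v n elements among the first n integers, for every n;
    - P v has density v whenever v is a limit of densities of members of D;
    - P (nu A) is equivalent to A for A in D.
    The exact bound on counts makes unions continuous: the union of the P v, for
    v in W, lies in P (sup W), so its counts are at most (sup W) n, and its
    density is at least every v in W. An intersection obeys the bound for inf W,
    and it contains P (inf W), whose density is inf W even when no member of D
    has this density. The bound on counts is also the last property required of
    the closure of the image of phi, and uniqueness follows by squeezing: two
    sets of density s that contain (or are contained in) equivalent sets of
    density close to s are equivalent ([null_symdiff_approx]).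

    The family P, called [layer], is built on the dyadic blocks [2^k, 2^(k+1)).
    A tolerance d = [mesh k], tending to 0 with k, is fixed on the block of scale
    k, and only those members B of D are used there whose counts are, from 2^k
    on, within a relative error d / 4 of their expected value. On the block, P v
    is the union of the members B that are so accurate and have density at most
    (1 + d) v, minus the first 2 d 2^k positions. Discarding these positions is
    what turns approximate counts into the exact bound ([hits_layer_block]), and
    it costs a null set since d tends to 0. As the B form a chain, on a block
    their union is one of them.

    For P v to be large enough there must be, on all late blocks, an accurate B
    of density close to v, uniformly in v. For fixed d this holds on all late
    blocks, as finitely many members of D approximate all the densities within
    d^2 ([net_near]), so d can be let go to 0 slowly enough ([mesh]). The
    factor 1 + d in the definition of P v leaves room for this approximation,
    also when v is only a limit from above of densities. *)

Set Implicit Arguments.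
Unset Strict Implicit.
Unset Printing Implicit Defensive.

(** * Unions and intersections of subfamilies of a chain *)

Section Comparable.
Variable T : Type.
Implicit Types (A B X Y : set T) (C F : set (set T)).

Definition comparable A B : Prop := A `<=` B \/ B `<=` A.

Lemma comparableC A B : comparable A B -> comparable B A.
Proof. by case; [right|left]. Qed.

Lemma comparable_bigcup C Y :
  (forall A, C A -> comparable A Y) -> comparable (\bigcup_(A in C) A) Y.
Proof.
move=> CY; have [CsubY|] := pselect (forall A, C A -> A `<=` Y).
  by left; apply: bigcup_sub.
move=> /existsNP[A /not_implyP[CA nAY]]; right.
have [//|YA] := CY A CA; exact: subset_trans YA (bigcup_sup CA).
Qed.

Lemma comparable_bigcap C Y :
  (forall A, C A -> comparable A Y) -> comparable (\bigcap_(A in C) A) Y.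
Proof.
move=> CY; have [YsubC|] := pselect (forall A, C A -> Y `<=` A).
  by right; apply: sub_bigcap.
move=> /existsNP[A /not_implyP[CA nYA]]; left.
have [AY|//] := CY A CA; exact: subset_trans (bigcap_inf CA) AY.
Qed.

Lemma comparable_star F Y :
  (forall A, F A -> comparable A Y) -> forall X, star F X -> comparable X Y.
Proof.
move=> FY X [] [C CF <-]; [apply: comparable_bigcup|apply: comparable_bigcap];
  by move=> A /CF /FY.
Qed.

(** Comparability with a fixed set passes from a family to its unions and
    intersections, so it extends from F to [star F] in one argument at a time. *)
Lemma chain_star F : chain F -> chain (star F).
Proof.
move=> cF X Y sX sY; apply: (comparable_star (F := F)) sX => A FA.
by apply/comparableC; apply: (comparable_star (F := F)) sY => B FB; exact: cF.
Qed.

End Comparable.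

(** * Counting and density *)

Section Counting.
Variable R : realType.
Implicit Types (A B X Y E : set posnat) (a b e : R) (m n : nat).

Definition hits A m n : R := \sum_(m <= i < n) \1_A (succ_pos i).

Lemma hits_cat A m n p : (m <= n)%N -> (n <= p)%N ->
  hits A m p = hits A m n + hits A n p.
Proof. by move=> mn np; rewrite /hits (big_cat_nat mn np). Qed.

Lemma hits_geq A m n : (n <= m)%N -> hits A m n = 0.
Proof. by move=> nm; rewrite /hits big_geq. Qed.

Lemma hits_le A B m n :
  (forall i, (m <= i < n)%N -> A (succ_pos i) -> B (succ_pos i)) ->
  hits A m n <= hits B m n.
Proof.
move=> AB; apply: ler_sum_nat => i imn; rewrite !indicE ler_nat.
by case: (boolP (_ \in A)) => //; rewrite inE => /(AB _ imn) Bi; rewrite mem_set.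
Qed.

Lemma hits_sub A B m n : A `<=` B -> hits A m n <= hits B m n.
Proof. by move=> AB; apply: hits_le => i _; exact: AB. Qed.

Lemma hits_set0 m n : hits set0 m n = 0.
Proof. by rewrite /hits big1// => i _; rewrite indicE in_set0. Qed.

Lemma hits_ge0 A m n : 0 <= hits A m n.
Proof. by rewrite -(hits_set0 m n) hits_sub. Qed.

Lemma hits_setT m n : (m <= n)%N -> hits setT m n = n%:R - m%:R.
Proof.
move=> mn; rewrite -natrB// /hits (eq_bigr (fun=> 1)) => [|i _].
  by rewrite sumr_const_nat.
by rewrite indicE in_setT.
Qed.

Lemma hits_le_size A m n : (m <= n)%N -> hits A m n <= n%:R - m%:R.
Proof. by move=> mn; rewrite -hits_setT// hits_sub. Qed.

Lemma hits_setU A B m n : hits (A `|` B) m n <= hits A m n + hits B m n.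
Proof.
rewrite /hits -big_split/=; apply: ler_sum => i _.
by rewrite !indicE in_setU -natrD ler_nat; do 2 case: (_ \in _).
Qed.

Lemma hits_symdiff A B m n :
  hits (A `+` B) m n = hits A m n + hits B m n - 2 * hits (A `&` B) m n.
Proof.
rewrite /hits mulr_sumr -big_split -sumrB/=; apply: eq_bigr => i _.
rewrite !indicE /setY in_setU !in_setD in_setI.
by do 2 case: (_ \in _) => /=; lra.
Qed.

Lemma hits_symdiff_comparable A B m n : comparable A B ->
  hits (A `+` B) m n = `|hits A m n - hits B m n|.
Proof.
rewrite hits_symdiff => -[] AB; have le := hits_sub m n AB.
  by rewrite setIidl// ler0_norm ?subr_le0//; lra.
by rewrite setIidr// ger0_norm ?subr_ge0//; lra.
Qed.

Lemma nuNE A n : nuN R A n = n%:R^-1 * hits A 0 n.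
Proof. by rewrite /nuN /hits big_mkord. Qed.

Lemma nuN_le A a n : (0 < n)%N -> (nuN R A n <= a) = (hits A 0 n <= a * n%:R).
Proof.
by move=> n0; rewrite nuNE ler_pdivrMl ?ltr0n// [X in _ = (_ <= X)]mulrC.
Qed.

(** Existence and value of the density in one statement, with the division by
    n cleared. *)
Definition dens A a : Prop := forall e, 0 < e ->
  \forall n \near \oo, `|hits A 0 n - a * n%:R| <= e * n%:R.

Lemma dens_cvg A a : dens A a <-> nuN R A n @[n --> \oo] --> a.
Proof.
have normE n e : (0 < n)%N ->
    (`|a - nuN R A n| <= e) = (`|hits A 0 n - a * n%:R| <= e * n%:R).
  move=> n0; have n0' : 0 < n%:R :> R by rewrite ltr0n.
  rewrite -(ler_pM2r n0') -{1}(gtr0_norm n0') -normrM nuNE distrC.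
  by congr (`| _ | <= _); field; rewrite gt_eqF.
split=> [dA|/cvgrPdist_le cA].
  apply/cvgrPdist_le => e e0; near=> n.
  by rewrite normE; [near: n; exact: dA|near: n; exact: (nbhs_infty_gt 0)].
move=> e e0; near=> n.
by rewrite -normE; [near: n; exact: cA|near: n; exact: (nbhs_infty_gt 0)].
Unshelve. all: by end_near. Qed.

Lemma densP A a : dens A a <-> has_density R A /\ density R A = a.
Proof.
rewrite dens_cvg; split=> [cA|[cA <-]]; last exact: cA.
by split; [exact: cvgP cA|exact: cvg_lim cA].
Qed.

Lemma has_densityP A : has_density R A -> dens A (density R A).
Proof. by move=> hA; apply/densP. Qed.

Lemma null_setsP E : null_sets R E <->
  forall e, 0 < e -> \forall n \near \oo, hits E 0 n <= e * n%:R.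
Proof.
rewrite null_setsE -dens_cvg; split=> dE e e0; have := dE e e0;
  by apply: filterS => n; rewrite mul0r subr0 ger0_norm// hits_ge0.
Qed.

Lemma slope_le a b :
  (forall e, 0 < e -> \forall n \near \oo, a * n%:R <= (b + e) * n%:R :> R) ->
  a <= b.
Proof.
move=> ab; apply/ler_addgt0Pr => e e0; have [N _ /(_ N.+1)] := ab e e0.
by rewrite /= leqnSn ler_pM2r ?ltr0n//; apply.
Qed.

Lemma dens_le_upper A a b : dens A a ->
  (\forall n \near \oo, hits A 0 n <= b * n%:R) -> a <= b.
Proof.
move=> dA Ab; apply: slope_le => e e0; near=> n.
have : `|hits A 0 n - a * n%:R| <= e * n%:R by near: n; exact: dA.
have : hits A 0 n <= b * n%:R by near: n.
rewrite ler_norml => ? /andP[]; lra.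
Unshelve. all: by end_near. Qed.

Lemma dens_le1 A a : dens A a -> a <= 1.
Proof.
move=> dA; apply: (dens_le_upper dA); apply: nearW => n.
by rewrite mul1r (le_trans (hits_le_size _ _))// subr0.
Qed.

Lemma dens_ge0 A a : dens A a -> 0 <= a.
Proof.
move=> dA; apply: slope_le => e e0; near=> n; rewrite mul0r.
have : `|hits A 0 n - a * n%:R| <= e * n%:R by near: n; exact: dA.
have := hits_ge0 A 0 n; rewrite ler_norml => ? /andP[]; lra.
Unshelve. all: by end_near. Qed.

Lemma dens_sub A B a b : A `<=` B -> dens A a -> dens B b -> a <= b.
Proof.
move=> AB dA dB; apply: slope_le => e e0.
  have e20 : 0 < e / 2 by lra.
near=> n.
have : `|hits A 0 n - a * n%:R| <= e / 2 * n%:R by near: n; exact: dA.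
have : `|hits B 0 n - b * n%:R| <= e / 2 * n%:R by near: n; exact: dB.
have := hits_sub 0 n AB; rewrite !ler_norml => ? /andP[? ?] /andP[]; lra.
Unshelve. all: by end_near. Qed.

Lemma dens_set0 : dens set0 0.
Proof.
move=> e /ltW e0; apply: nearW => n.
by rewrite hits_set0 mul0r subr0 normr0 mulr_ge0.
Qed.

Lemma dens_setT : dens setT 1.
Proof.
move=> e /ltW e0; apply: nearW => n.
by rewrite hits_setT// mul1r subr0 subrr normr0 mulr_ge0.
Qed.

(** The difference X `+` Y is covered by X `+` A, A `+` B and B `+` Y. The middle
    one is null; comparable sets differ by as much as their counts do, so that
    the outer two have upper density at most |a - b|. *)
Lemma null_symdiff_approx X Y a : dens X a -> dens Y a ->
  (forall e, 0 < e -> exists A B b,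
    [/\ comparable X A, comparable B Y, null_sets R (A `+` B),
        dens A b /\ dens B b & `|a - b| <= e]) ->
  null_sets R (X `+` Y).
Proof.
move=> dX dY approx; apply/null_setsP => e e0.
have f0 : 0 < e / 7 by lra.
have [A [B [b [XA BY /null_setsP nAB [dA dB] ab]]]] := approx _ f0.
near=> n.
have hX : `|hits X 0 n - a * n%:R| <= e / 7 * n%:R by near: n; exact: dX.
have hY : `|hits Y 0 n - a * n%:R| <= e / 7 * n%:R by near: n; exact: dY.
have hA : `|hits A 0 n - b * n%:R| <= e / 7 * n%:R by near: n; exact: dA.
have hB : `|hits B 0 n - b * n%:R| <= e / 7 * n%:R by near: n; exact: dB.
have hAB : hits (A `+` B) 0 n <= e / 7 * n%:R by near: n; exact: nAB.
have hab : `|a * n%:R - b * n%:R| <= e / 7 * n%:R.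
  by rewrite -mulrBl normrM [`|n%:R|]ger0_norm// ler_wpM2r.
have XY : X `+` Y `<=` (X `+` A) `|` ((A `+` B) `|` (B `+` Y)).
  by move=> i; have := EM (A i); have := EM (B i); rewrite /setY/=; tauto.
have := hits_sub 0 n XY.
have := hits_setU (X `+` A) ((A `+` B) `|` (B `+` Y)) 0 n.
have := hits_setU (A `+` B) (B `+` Y) 0 n.
rewrite (hits_symdiff_comparable _ _ XA) (hits_symdiff_comparable _ _ BY).
have : `|hits X 0 n - hits A 0 n| <= 3 / 7 * e * n%:R.
  by move: hX hA hab; rewrite !ler_norml; lra.
have : `|hits B 0 n - hits Y 0 n| <= 3 / 7 * e * n%:R.
  by move: hY hB hab; rewrite !ler_norml; lra.
lra.
Unshelve. all: by end_near. Qed.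

Lemma dens_null_symdiff A B a : null_sets R (A `+` B) -> dens A a -> dens B a.
Proof.
move=> /null_setsP nAB dA e e0;
  have e20 : 0 < e / 2 by lra.
near=> n.
have : `|hits A 0 n - a * n%:R| <= e / 2 * n%:R by near: n; exact: dA.
have : hits (A `+` B) 0 n <= e / 2 * n%:R by near: n; exact: nAB.
rewrite hits_symdiff.
have := hits_sub 0 n (@subIsetl _ A B); have := hits_sub 0 n (@subIsetr _ A B).
rewrite !ler_norml; lra.
Unshelve. all: by end_near. Qed.

End Counting.
(** * Accurate members of the chain *)

Section Layers.
Variable R : realType.
Variable D : set (set posnat).
Hypotheses (chainD : chain D) (DF : D `<=` has_density R).
Implicit Types (A B X Y E : set posnat) (d v e : R) (i k m n : nat).

Local Notation nu := (density R).

Lemma near_pow2 (P : nat -> Prop) : (\forall n \near \oo, P n) ->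
  \forall k \near \oo, forall n, (2 ^ k <= n)%N -> P n.
Proof.
move=> [N _ hN]; exists N => // k Nk n kn; apply: hN => /=.
exact: leq_trans Nk (leq_trans (ltnW (ltn_expl _ _)) kn).
Qed.

Let densD A : D A -> dens A (nu A).
Proof. by move=> /DF /has_densityP. Qed.

(** The error is relative to [nu B], so that discarding a proportion 2 d of a
    block outweighs it whatever the density of B is. *)
Definition accurate d k B : Prop := 0 < nu B /\
  forall n, (2 ^ k <= n)%N ->
    `|hits R B 0 n - nu B * n%:R| <= d / 4 * nu B * n%:R.

Definition net d k : Prop := forall A, D A -> 0 < nu A ->
  exists B, [/\ D B, accurate d k B & `|nu B - nu A| <= d ^+ 2].

Lemma accurate_near d B : 0 < d -> D B -> 0 < nu B ->
  \forall k \near \oo, accurate d k B.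
Proof.
move=> d0 DB nB0; have e0 : 0 < d / 4 * nu B by rewrite mulr_gt0 ?divr_gt0.
by have := near_pow2 (densD DB e0); apply: filterS => k aB; split.
Qed.

Lemma accurate_mono d d' k k' B : d <= d' -> (k <= k')%N ->
  accurate d k B -> accurate d' k' B.
Proof.
move=> dd' kk' [B0 aB]; split=> // n kn; apply: le_trans (aB n _) _.
  by rewrite (leq_trans _ kn)// leq_exp2l.
by rewrite ler_wpM2r// ler_wpM2r ?(ltW B0)//; lra.
Qed.

Lemma net_mono d d' k k' : 0 <= d -> d <= d' -> (k <= k')%N ->
  net d k -> net d' k'.
Proof.
move=> d0 dd' kk' nd A DA A0; have [B [DB aB BA]] := nd A DA A0.
exists B; split=> //; first exact: accurate_mono aB.
by rewrite (le_trans BA)// lerXn2r// nnegrE (le_trans d0).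
Qed.

(** Cut [0, 1] into intervals of length d ^+ 2; one set of positive density
    chosen in each of these finitely many intervals serves for all. *)
Lemma net_near d : 0 < d -> \forall k \near \oo, net d k.
Proof.
move=> d0; have dd0 : 0 < d ^+ 2 by rewrite exprn_gt0.
pose cell A := Num.truncn (nu A / d ^+ 2).
pose M := (Num.truncn (d ^+ 2)^-1).+1.
have cellM A : D A -> (cell A < M)%N.
  move=> DA; rewrite ltnS; apply: le_truncn.
  by rewrite ler_pdivrMr// mulVf ?gt_eqF// (dens_le1 (densD DA)).
have cell_near A B : D A -> D B -> cell A = cell B -> `|nu B - nu A| <= d ^+ 2.
  move=> DA DB AB.
  have bnd E : D E -> (cell E)%:R * d ^+ 2 <= nu E /\
      nu E <= ((cell E)%:R + 1) * d ^+ 2.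
    move=> DE; have nE : 0 <= nu E / d ^+ 2.
      by rewrite divr_ge0 ?(dens_ge0 (densD DE))// ltW.
    have /andP[? /ltW ?] := truncn_itv nE.
    by split; [rewrite -ler_pdivlMr|rewrite -ler_pdivrMr// natr1].
  have [] := bnd A DA; have [] := bnd B DB; rewrite AB ler_norml; lra.
suff : \forall k \near \oo, forall c : 'I_M, forall A, D A -> 0 < nu A ->
    cell A = c -> exists B, [/\ D B, accurate d k B & `|nu B - nu A| <= d ^+ 2].
  apply: filterS => k nk A DA A0.
  exact: (nk (Ordinal (cellM A DA)) A DA A0).
apply: filter_forall => c.
have [[B [DB B0 Bc]]|none] := pselect (exists B, [/\ D B, 0 < nu B & cell B = c]).
  apply: filterS (accurate_near d0 DB B0) => k aB A DA A0 Ac.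
  by exists B; split=> //; apply: cell_near => //; rewrite Ac Bc.
by apply: nearW => k A DA A0 Ac; exfalso; apply: none; exists A.
Qed.

(** As [net d k] is monotone in d and in k, the infimum of the admissible d at
    scale k, increased by 1 / (k + 1) to make it admissible, tends to 0. *)
Definition mesh k : R := inf [set d | 0 <= d /\ net d k] + k.+1%:R^-1.

Lemma mesh_gt0 k : 0 < mesh k.
Proof.
rewrite ltr_wpDl ?invr_gt0 ?ltr0n//.
have [->|/set0P ne] := eqVneq [set d | 0 <= d /\ net d k] set0.
  by rewrite inf0.
by apply: lb_le_inf => // d [].
Qed.

Lemma net_mesh : \forall k \near \oo, net (mesh k) k.
Proof.
have := net_near ltr01; apply: filterS => k n1.
have [||d [d0 nd] dlt] := @inf_lt _ [set d | 0 <= d /\ net d k] (mesh k).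
- by exists 1; split.
- by rewrite ltrDl invr_gt0 ltr0n.
- exact: net_mono (ltW dlt) _ nd.
Qed.

Lemma mesh_near e : 0 < e -> \forall k \near \oo, mesh k <= e.
Proof.
move=> e0; have e20 : 0 < e / 2 by lra.
near=> k.
have : k.+1%:R^-1 < e / 2.
  by near: k; exact: (near_infty_natSinv_lt (PosNum e20)).
have : inf [set d | 0 <= d /\ net d k] <= e / 2.
  apply: ge_inf; first by exists 0 => d [].
  by split; [exact: ltW|near: k; exact: net_near].
by move=> ? /ltW ?; rewrite /mesh [leRHS]splitr lerD.
Unshelve. all: by end_near. Qed.

(** * Layers *)

(** First position of the block [2 ^ k, 2 ^ k.+1) that is not discarded; it may
    lie beyond the end of the block when [mesh k] is large. *)
Definition start k : nat := (2 ^ k + (Num.truncn (2 * mesh k * 2 ^+ k)).+1)%N.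

Lemma start_ge k : (1 + 2 * mesh k) * 2 ^+ k <= (start k)%:R.
Proof.
have := truncnS_gt (2 * mesh k * 2 ^+ k); rewrite /start natrD natrX; lra.
Qed.

Lemma start_le k : (start k)%:R <= (1 + 2 * mesh k) * 2 ^+ k + 1.
Proof.
have : 0 <= 2 * mesh k * 2 ^+ k.
  by rewrite mulr_ge0 ?exprn_ge0// mulr_ge0// ltW// mesh_gt0.
move=> /truncn_itv/andP[+ _].
by rewrite /start natrD natrX -[(Num.truncn _).+1%:R]natr1; lra.
Qed.

Lemma start_gt k : (2 ^ k < start k)%N.
Proof. by rewrite /start addnS ltnS leq_addr. Qed.

Definition admissible v k B : Prop :=
  [/\ D B, accurate (mesh k) k B & nu B <= (1 + mesh k) * v].

(** The scale k of a position is quantified; [layerP] shows that it can only be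
    that of the block containing the position. *)
Definition layer v : set posnat :=
  [set p | exists k B, [/\ (start k <= (sval p).-1 < 2 ^ k.+1)%N,
                           admissible v k B & B p]].

Lemma layerP v i k : (2 ^ k <= i < 2 ^ k.+1)%N -> layer v (succ_pos i) <->
  (start k <= i)%N /\ exists2 B, admissible v k B & B (succ_pos i).
Proof.
move=> ik; split=> [[k' [B [/andP[ki ik'] aB Bi]]]|[ki [B aB Bi]]]; last first.
  by exists k, B; split=> //=; case/andP: ik => _ ->; rewrite ki.
have ik2 : (2 ^ k' <= i < 2 ^ k'.+1)%N.
  by rewrite ik' andbT (leq_trans (ltnW (start_gt k')) ki).
have kk' : k = k' by rewrite -(trunc_log_eq (p := 2) _ ik)// (trunc_log_eq _ ik2).
by rewrite kk'; split=> //; exists B.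
Qed.

Lemma layer_mono v w : v <= w -> layer v `<=` layer w.
Proof.
move=> vw p [k [B [kp [DB aB Bv] Bp]]]; exists k, B; split=> //; split=> //.
by rewrite (le_trans Bv)// ler_wpM2l// addr_ge0// ltW// mesh_gt0.
Qed.

(** Infinitely many sets may be admissible at one scale. Their union is still
    counted as a single set, since the set may depend on the bound n. *)
Lemma chain_bigcup_fin (G : set (set posnat)) n : G `<=` D -> G !=set0 ->
  exists2 B, G B & forall i, (i < n)%N ->
    (\bigcup_(A in G) A) (succ_pos i) -> B (succ_pos i).
Proof.
move=> GD [A0 GA0]; elim: n => [|n [B GB IH]]; first by exists A0.
have [[A GA An]|none] := pselect ((\bigcup_(A in G) A) (succ_pos n)); last first.
  exists B => // i; rewrite ltnS leq_eqVlt => /predU1P[->|]; [by []|exact: IH].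
have [AB|BA] := chainD (GD _ GA) (GD _ GB).
  exists B => // i; rewrite ltnS leq_eqVlt => /predU1P[-> _|]; last exact: IH.
  exact: AB.
exists A => // i; rewrite ltnS leq_eqVlt => /predU1P[->//|ni /(IH _ ni)].
exact: BA.
Qed.

(** Let d = [mesh k], and let B be the admissible set that the layer agrees with.
    The count of B between [start k] and n is at most nu B (n - start k), plus an
    error d / 4 (nu B) (n + start k) <= d (nu B) 2^k. As start k is at least
    (1 + 2 d) 2^k and nu B is at most (1 + d) v, it remains to see that
    (1 + d) (n - 2^k - d 2^k) <= n - 2^k, which holds as n <= 2^(k+1). *)
Lemma hits_layer_block v k n : 0 <= v -> (2 ^ k <= n <= 2 ^ k.+1)%N ->
  hits R (layer v) (2 ^ k) n <= v * (n%:R - 2 ^+ k).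
Proof.
move=> v0 /andP[kn nk]; have d0 := mesh_gt0 k.
set d := mesh k in d0 *; set M : R := 2 ^+ k.
have M0 : 0 < M by rewrite exprn_gt0.
have Mn : M <= n%:R by rewrite /M -natrX ler_nat.
have nM : n%:R <= 2 * M by rewrite /M -exprS -natrX ler_nat.
have rhs0 : 0 <= v * (n%:R - M) by rewrite mulr_ge0// subr_ge0.
have [Z|/set0P ne] := eqVneq (admissible v k) set0.
  apply: le_trans rhs0; rewrite -(hits_set0 R (2 ^ k) n); apply: hits_le => i.
  move=> /andP[ki iN] /layerP-/(_ k)[|_ [B]]; last by rewrite Z.
  by rewrite ki (leq_trans iN).
have [B [DB [B0 aB] Bv] hB] :=
  @chain_bigcup_fin _ n (fun B => fun '(And3 DB _ _) => DB) ne.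
have inB i : (2 ^ k <= i < n)%N -> layer v (succ_pos i) ->
    (start k <= i)%N /\ B (succ_pos i).
  move=> /andP[ki iN] /layerP-/(_ k)[|si [A aA Ai]].
    by rewrite ki (leq_trans iN).
  by split=> //; apply: hB => //; exists A.
have [nstart|startn] := leqP n (start k).
  apply: le_trans rhs0; rewrite -(hits_set0 R (2 ^ k) n); apply: hits_le => i.
  move=> ikn /(inB _ ikn)[si _]; case/andP: ikn => _ /leq_trans/(_ nstart).
  by rewrite ltnNge si.
have ks := start_gt k.
have -> : hits R (layer v) (2 ^ k) n = hits R (layer v) (start k) n.
  rewrite (hits_cat _ _ (ltnW ks) (ltnW startn)) [X in X + _](_ : _ = 0) ?add0r//.
  apply/eqP; rewrite eq_le hits_ge0 andbT -(hits_set0 R (2 ^ k) (start k)).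
  apply: hits_le => i /andP[ki is_] /inB[|]; last by rewrite leqNgt is_.
  by rewrite ki (ltn_trans is_).
have : hits R (layer v) (start k) n <= hits R B (start k) n.
  apply: hits_le => i /andP[si iN] /inB[|_ //].
  by rewrite iN (leq_trans (ltnW ks)).
have := aB _ kn; have := aB _ (ltnW ks).
have := hits_cat R B (leq0n _) (ltnW startn) => ->.
have := start_ge k; rewrite -/d -/M.
have : (start k)%:R <= n%:R :> R by rewrite ler_nat ltnW.
set s := (start k)%:R; set x := n%:R in Mn nM rhs0 *.
rewrite !ler_norml => sx sM /andP[h1 _] /andP[_ h2] h3.
have h5 : hits R (layer v) (start k) n <= nu B * (x - M - d * M).
  have : d / 4 * nu B * (x + s) <= d / 4 * nu B * (4 * M).
    by apply: ler_wpM2l; [rewrite !mulr_ge0 ?invr_ge0 ?ltW|lra].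
  have : nu B * s >= nu B * ((1 + 2 * d) * M) by rewrite ler_wpM2l// ltW.
  lra.
apply: le_trans h5 _; have [neg|pos] := leP (x - M - d * M) 0.
  by apply: le_trans rhs0; rewrite pmulr_rle0.
apply: le_trans (ler_wpM2r (ltW pos) Bv) _; rewrite -/d.
have : 0 <= v * (d * (2 * M - x)) by rewrite !mulr_ge0 ?subr_ge0// ltW.
have : 0 <= v * (d ^+ 2 * M) by rewrite !mulr_ge0 ?exprn_ge0// ltW.
lra.
Qed.

Lemma hits_layer v n : 0 <= v -> hits R (layer v) 0 n <= v * n%:R.
Proof.
move=> v0; elim/ltn_ind: n => -[|[|n]] IH.
- by rewrite hits_geq// mulr0.
- (* Position 0 lies in no dyadic block. *)
  rewrite mulr1 (le_trans _ v0)// -(hits_set0 R 0 1); apply: hits_le => -[|//] _.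
  by move=> [k [B []]] /=; have := start_gt k; case: (start k).
have := trunc_log_bounds (p := 2) isT (ltn0Sn n).
set k := trunc_log 2 n.+1 => /= /andP[kn nk].
have kn2 : (2 ^ k < n.+2)%N by rewrite ltnS.
rewrite (hits_cat _ _ (leq0n _) (ltnW kn2)).
have := IH _ kn2; have := @hits_layer_block v k n.+2 v0.
rewrite (ltnW kn2) nk => /(_ isT); rewrite natrX; lra.
Qed.

(** To see that h n is eventually below e n, it is enough to bound its
    growth inside each dyadic block by a small multiple of the length of the
    block, as the lengths of the blocks before 2 ^ k sum to at most 2 ^ k. *)
Lemma dyadic_growth (h : nat -> R) e : 0 < e ->
  (\forall k \near \oo, forall n, (2 ^ k <= n <= 2 ^ k.+1)%N ->
     h n <= h (2 ^ k)%N + e / 3 * 2 ^+ k) ->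
  \forall n \near \oo, h n <= e * n%:R.
Proof.
move=> e0 [K _ hK].
have powK j : h (2 ^ (K + j))%N <= h (2 ^ K)%N + e / 3 * 2 ^+ (K + j).
  elim: j => [|j IH].
    by rewrite addn0 lerDl mulr_ge0 ?exprn_ge0//; lra.
  rewrite addnS; have := hK (K + j)%N (leq_addr _ _) (2 ^ (K + j).+1)%N.
  rewrite leqnn andbT leq_exp2l// leqnSn => /(_ isT).
  rewrite exprS; lra.
near=> n.
have Kn : (2 ^ K <= n)%N by near: n; exact: nbhs_infty_ge.
have hKn : h (2 ^ K)%N <= e / 3 * n%:R.
  rewrite -ler_pdivrMl ?divr_gt0//; near: n; exact: nbhs_infty_ger.
have n0 : (0 < n)%N by rewrite (leq_trans _ Kn)// expn_gt0.
have := trunc_log_bounds (p := 2) isT n0.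
set k := trunc_log 2 n => /= /andP[kn nk].
have Kk : (K <= k)%N.
  by rewrite -ltnS -(ltn_exp2l (m := 2))// (leq_ltn_trans Kn).
have := hK k Kk n; rewrite kn (ltnW nk) => /(_ isT).
have := powK (k - K)%N; rewrite subnKC//.
have : e / 3 * 2 ^+ k <= e / 3 * n%:R.
  by apply: ler_wpM2l; [rewrite divr_ge0 ?ltW|rewrite -natrX ler_nat].
lra.
Unshelve. all: by end_near. Qed.

(** For X = setT this gives the density of a layer; for X in D and v = nu X, it
    shows that the layer of level v contains X up to a null set. On a late block
    the layer contains, beyond the discarded positions, an accurate B in D of
    density close to v. As X `&` B is X or B by comparability, its density is at
    least about v. *)
Lemma hits_layer_lower v X x e : 0 <= v ->
  (forall d, 0 < d -> exists2 A, D A & `|nu A - v| <= d) ->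
  (forall B, D B -> comparable X B) -> dens X x -> v <= x -> 0 < e ->
  \forall n \near \oo, (v - e) * n%:R <= hits R (X `&` layer v) 0 n.
Proof.
move=> v0 limv cX dX vx e0.
have [v_eq0|v_gt0] := leP v 0.
  apply: nearW => n; apply: le_trans (hits_ge0 R _ _ _).
  by apply: mulr_le0_ge0 => //; lra.
suff : \forall n \near \oo,
    v * n%:R - hits R (X `&` layer v) 0 n <= e * n%:R.
  by apply: filterS => n; lra.
(* The loss on a block is at most 9 f times its length, within e / 3 = 20 f: 3 f
   from the discarded positions and the rounding of their number, 2 f from the
   density of the set Y that is counted below, 4 f from its two counts. *)
apply: (@dyadic_growth (fun n => v * n%:R - hits R (X `&` layer v) 0 n)) => //.
pose f := e / 60; have f0 : 0 < f by rewrite divr_gt0.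
pose g := Num.min f (Num.min 1 (v / 2)).
have g0 : 0 < g by rewrite !lt_min f0 ltr01 divr_gt0.
have [gf g1 gv] : [/\ g <= f, g <= 1 & g <= v / 2].
  by rewrite !ge_min !lexx !orbT.
near=> k.
have ak : mesh k <= g by near: k; exact: mesh_near.
have nk : net (mesh k) k by near: k; exact: net_mesh.
have Xk n : (2 ^ k <= n)%N -> `|hits R X 0 n - x * n%:R| <= f * n%:R.
  by move: n; near: k; exact: near_pow2 (dX _ f0).
have fk : 1 <= f * 2 ^+ k.
  suff : f^-1 <= (2 ^ k)%:R by rewrite natrX -ler_pdivrMl// mulr1.
  by near: k; have := near_pow2 (nbhs_infty_ger f^-1); apply: filterS => k; apply.
have d0 := mesh_gt0 k.
move: d0 ak nk; set d := mesh k => d0 dg nk n /andP[kn kn2].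
set M : R := 2 ^+ k; have M0 : 0 < M by rewrite exprn_gt0.
have Mn : M <= n%:R by rewrite /M -natrX ler_nat.
have nM : n%:R <= 2 * M by rewrite /M -exprS -natrX ler_nat.
have dd : d ^+ 2 <= f by rewrite expr2; nra.
(* A member A of D stands for v, which need not be a density itself; the bound
   v / 2 keeps the density of A positive. *)
have [A DA Av] : exists2 A, D A & `|nu A - v| <= Num.min (d ^+ 2) (v / 2).
  by apply: limv; rewrite lt_min exprn_gt0 ?divr_gt0.
move: Av; rewrite le_min => /andP[Av Av2].
have A0 : 0 < nu A by move: Av2; rewrite ler_norml; lra.
have [B [DB aB BA]] := nk A DA A0.
have B1 := dens_le1 (densD DB).
have Bv : `|nu B - v| <= 2 * d ^+ 2.
  by move: Av BA; rewrite !ler_norml; lra.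
have admB : admissible v k B.
  split=> //; rewrite -/d; have : 0 <= d * (v - 2 * d).
    by rewrite mulr_ge0 ?subr_ge0 ?(ltW d0)//; lra.
  by move: Bv; rewrite ler_norml; lra.
rewrite (hits_cat _ _ (leq0n _) kn) natrX -/M.
suff : v * (n%:R - M) - e / 3 * M <= hits R (X `&` layer v) (2 ^ k) n by lra.
have v1 : v <= 1 by rewrite (le_trans vx)// (dens_le1 dX).
have sM := start_le k; rewrite -/d -/M in sM fk.
have dM : d * M <= f * M by rewrite ler_wpM2r ?(ltW M0)//; lra.
have fM0 : 0 <= f * M by rewrite mulr_ge0 ?ltW.
have eE : e / 3 * M = 20 * (f * M) by rewrite /f; field.
have [nstart|startn] := leqP n (start k).
  apply: le_trans (hits_ge0 R _ _ _).
  have : n%:R <= (start k)%:R :> R by rewrite ler_nat.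
  have : v * (n%:R - M) <= n%:R - M by rewrite ler_piMl// subr_ge0.
  lra.
have ks := start_gt k.
have sn : (start k)%:R <= n%:R :> R by rewrite ler_nat ltnW.
have Ms : M <= (start k)%:R by rewrite /M -natrX ler_nat ltnW.
have [Y [y [XBY yv hY]]] : exists Y y, [/\ Y `<=` X `&` B, v - 2 * f <= y &
    forall m, (2 ^ k <= m)%N -> `|hits R Y 0 m - y * m%:R| <= f * m%:R].
  have [XB|BX] := cX B DB.
    by exists X, x; split=> //; [move=> p Xp; split=> //; exact: XB|lra].
  exists B, (nu B); split=> [p Bp||]; first by split=> //; exact: BX.
    by move: Bv; rewrite ler_norml; lra.
  move=> m km; apply: le_trans (proj2 aB m km) _; rewrite ler_wpM2r//.
  have := dens_ge0 (densD DB); rewrite -/d; nra.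
have : hits R Y (start k) n <= hits R (X `&` layer v) (2 ^ k) n.
  rewrite (hits_cat _ _ (ltnW ks) (ltnW startn)) ler_wpDl ?hits_ge0//.
  apply: hits_le => i /andP[si iN] /XBY[Xi Bi]; split=> //.
  apply/(@layerP _ _ k); first by rewrite (leq_trans (ltnW ks) si) (leq_trans iN).
  by split=> //; exists B.
have := hY _ kn; have := hY _ (ltnW ks).
rewrite (hits_cat R Y (leq0n _) (ltnW startn)).
set s := (start k)%:R in sM sn Ms *; set z := n%:R in Mn nM sn *.
have : f * (z + s) <= f * (4 * M) by apply: ler_wpM2l; [exact: ltW|lra].
have : (v - 2 * f) * (z - s) <= y * (z - s) by apply: ler_wpM2r => //; lra.
have : f * (z - s) <= f * M by apply: ler_wpM2l; [exact: ltW|lra].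
have : v * (s - M) <= s - M by rewrite ler_piMl// subr_ge0.
rewrite !ler_norml => h1 h2 h3 h4 /andP[h5 h6] /andP[h7 h8] h9.
lra.
Unshelve. all: by end_near. Qed.
(** * The canonical representative of a class *)

Lemma dens_layer v : 0 <= v ->
  (forall d, 0 < d -> exists2 A, D A & `|nu A - v| <= d) -> dens (layer v) v.
Proof.
move=> v0 limv.
have v1 : v <= 1.
  apply/ler_addgt0Pr => d /limv[A DA]; rewrite ler_norml.
  by have := dens_le1 (densD DA); lra.
have cT B : D B -> comparable setT B by right.
move=> e e0; have := hits_layer_lower v0 limv cT (@dens_setT R) v1 e0.
apply: filterS => n; rewrite setTI ler_norml => lower.
have := hits_layer n v0; have : 0 <= e * n%:R by rewrite mulr_ge0// ltW.
lra.
Qed.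

Definition canon A : set posnat := layer (nu A).

Lemma nu_limit A : D A ->
  forall d, 0 < d -> exists2 B, D B & `|nu B - nu A| <= d.
Proof. by move=> DA d /ltW d0; exists A => //; rewrite subrr normr0. Qed.

Lemma dens_canon A : D A -> dens (canon A) (nu A).
Proof.
by move=> DA; apply: dens_layer (nu_limit DA); exact: dens_ge0 (densD DA).
Qed.

Lemma canon_equiv A : D A -> null_sets R (canon A `+` A).
Proof.
move=> DA; apply/null_setsP => e e0; have e40 : 0 < e / 4 by lra.
have A0 := dens_ge0 (densD DA); have cA B : D B -> comparable A B by exact: chainD.
have lower := hits_layer_lower A0 (nu_limit DA) cA (densD DA) (lexx _) e40.
near=> n; rewrite setYC hits_symdiff.
have : (nu A - e / 4) * n%:R <= hits R (A `&` layer (nu A)) 0 n by near: n.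
have : `|hits R A 0 n - nu A * n%:R| <= e / 4 * n%:R.
  by near: n; exact: densD.
have := hits_layer n A0; rewrite -/(canon A) ler_norml; lra.
Unshelve. all: by end_near. Qed.

Lemma nu_eq_null A B : D A -> D B -> null_sets R (A `+` B) -> nu A = nu B.
Proof.
move=> DA DB AB.
by have /densP[_] := dens_null_symdiff AB (densD DA).
Qed.

Lemma canon_eqP A B : D A -> D B ->
  null_sets R (A `+` B) <-> canon A = canon B.
Proof.
move=> DA DB; split=> [AB|AB]; first by rewrite /canon (nu_eq_null DA DB AB).
have nA := canon_equiv DA; have := canon_equiv DB; rewrite -AB => nB.
apply: null_sets_subU nA nB => p; rewrite /setY/=.
by have := EM (canon A p); tauto.
Qed.

Lemma canon_properP A B : D A -> D B ->
  dclass_lt R (dclass R A) (dclass R B) <-> canon A `<` canon B.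
Proof.
move=> DA DB; rewrite /dclass_lt dclass_leP dclass_eqP canon_eqP//.
split=> [[AB neq]|[AB BA]].
  have le : nu A <= nu B.
    have [sAB|sBA] := chainD DA DB.
      exact: dens_sub sAB (densD DA) (densD DB).
    exfalso; apply/neq/canon_eqP => //.
    apply: null_sets_subU AB (null_sets0 R) => p.
    by have := sBA p; rewrite /setY/=; tauto.
  have cAB : canon A `<=` canon B by exact: layer_mono.
  by split=> // cBA; apply: neq; apply/seteqP.
split; last by move=> eqAB; apply: BA; rewrite eqAB.
apply: null_sets_subU (canon_equiv DA) (canon_equiv DB) => p; rewrite /setY/=.
by have := AB p; have := EM (canon A p); have := EM (canon B p); tauto.
Qed.

Lemma sup01_nonempty W : W !=set0 -> sup01 W = sup W :> R.
Proof. by move=> /set0P/eqP W0; rewrite /sup01; case: asboolP. Qed.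

Lemma inf01_nonempty W : W !=set0 -> inf01 W = inf W :> R.
Proof. by move=> /set0P/eqP W0; rewrite /inf01; case: asboolP. Qed.

Lemma sup01_set0 : sup01 set0 = 0 :> R.
Proof. by rewrite /sup01; case: asboolP. Qed.

Lemma inf01_set0 : inf01 set0 = 1 :> R.
Proof. by rewrite /inf01; case: asboolP. Qed.

Section Families.
Variable S : set (set posnat).
Hypothesis SD : S `<=` D.

Local Notation W := (nu @` S).

Lemma nu_ub : has_ubound W.
Proof. by exists 1 => _ [A /SD DA <-]; exact: dens_le1 (densD DA). Qed.

Lemma nu_lb : has_lbound W.
Proof. by exists 0 => _ [A /SD DA <-]; exact: dens_ge0 (densD DA). Qed.

Lemma nu_le_sup A : S A -> nu A <= sup W.
Proof. by move=> SA; apply: (ub_le_sup nu_ub); exists A. Qed.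

Lemma inf_le_nu A : S A -> inf W <= nu A.
Proof. by move=> SA; apply: (ge_inf nu_lb); exists A. Qed.

Lemma sup_limit e : S !=set0 -> 0 < e -> exists2 A, S A & `|nu A - sup W| <= e.
Proof.
move=> [A0 SA0] e0.
have [|_ [A SA <-] Ae] := @sup_adherent _ W e e0.
  by split; [exists (nu A0), A0|exact: nu_ub].
exists A => //; rewrite ler_norml.
by have := nu_le_sup SA; lra.
Qed.

Lemma inf_limit e : S !=set0 -> 0 < e -> exists2 A, S A & `|nu A - inf W| <= e.
Proof.
move=> [A0 SA0] e0.
have [|_ [A SA <-] Ae] := @inf_adherent _ W e e0.
  by split; [exists (nu A0), A0|exact: nu_lb].
exists A => //; rewrite ler_norml.
by have := inf_le_nu SA; lra.
Qed.

(** The union lies in the layer of level sup W, whose counts bound its density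
    from above. *)
Lemma bigcup_canon : dens (\bigcup_(A in S) canon A) (sup01 W) /\
  forall n, hits R (\bigcup_(A in S) canon A) 0 n <= sup01 W * n%:R.
Proof.
have [->|/set0P S0] := eqVneq S set0.
  rewrite bigcup_set0 image_set0 sup01_set0; split; first exact: dens_set0.
  by move=> n; rewrite hits_set0 mul0r.
rewrite sup01_nonempty; last by case: S0 => A SA; exists (nu A), A.
have upper n : hits R (\bigcup_(A in S) canon A) 0 n <= sup W * n%:R.
  apply: le_trans (hits_layer n _); last first.
    case: S0 => A SA; apply: le_trans (dens_ge0 (densD (SD SA))) _.
    exact: nu_le_sup.
  apply: hits_sub; apply: bigcup_sub => A SA; apply: layer_mono.
  exact: nu_le_sup.
split=> // e e0; have e20 : 0 < e / 2 by lra.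
have [A SA Ae] := sup_limit S0 e20.
near=> n.
have : `|hits R (canon A) 0 n - nu A * n%:R| <= e / 2 * n%:R.
  by near: n; exact: dens_canon (SD SA) _ e20.
have := hits_sub R 0 n (bigcup_sup (F := canon) SA).
have : (sup W - e / 2) * n%:R <= nu A * n%:R.
  by rewrite ler_wpM2r//; move: Ae; rewrite ler_norml; lra.
have : 0 <= e * n%:R by rewrite mulr_ge0// ltW.
have := upper n; rewrite !ler_norml; lra.
Unshelve. all: by end_near. Qed.

(** The intersection contains the layer of level inf W. No member of D need
    have density inf W: this is what requires the density of layers at limits. *)
Lemma bigcap_canon : dens (\bigcap_(A in S) canon A) (inf01 W) /\
  forall n, hits R (\bigcap_(A in S) canon A) 0 n <= inf01 W * n%:R.
Proof.
have [->|/set0P S0] := eqVneq S set0.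
  rewrite bigcap_set0 image_set0 inf01_set0; split; first exact: dens_setT.
  by move=> n; rewrite hits_setT// subr0 mul1r.
have W0 : W !=set0 by case: S0 => A SA; exists (nu A), A.
rewrite inf01_nonempty//.
have upper n : hits R (\bigcap_(A in S) canon A) 0 n <= inf W * n%:R.
  have [->|n0] := posnP n; first by rewrite hits_geq// mulr0.
  rewrite -ler_pdivrMr ?ltr0n//; apply: lb_le_inf => // _ [A SA <-].
  rewrite ler_pdivrMr ?ltr0n//; apply: le_trans (hits_layer n _).
    by apply: hits_sub; exact: bigcap_inf.
  exact: dens_ge0 (densD (SD SA)).
split=> // e e0.
have i0 : 0 <= inf W.
  by apply: lb_le_inf => // _ [A SA <-]; exact: dens_ge0 (densD (SD SA)).
have lim d : 0 < d -> exists2 A, D A & `|nu A - inf W| <= d.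
  by move=> /(inf_limit S0)[A SA Ad]; exists A => //; exact: SD.
near=> n.
have : `|hits R (layer (inf W)) 0 n - inf W * n%:R| <= e * n%:R.
  by near: n; exact: dens_layer lim _ e0.
have : hits R (layer (inf W)) 0 n <= hits R (\bigcap_(A in S) canon A) 0 n.
  apply: hits_sub; apply: sub_bigcap => A SA; apply: layer_mono.
  exact: inf_le_nu.
have : 0 <= e * n%:R by rewrite mulr_ge0// ltW.
have := upper n; rewrite !ler_norml; lra.
Unshelve. all: by end_near. Qed.

Variable rho : set posnat -> set posnat.
Hypothesis rho_equiv : forall A, S A -> null_sets R (rho A `+` A).

Lemma dens_rho A : S A -> dens (rho A) (nu A).
Proof.
move=> SA; apply: dens_null_symdiff (densD (SD SA)).
by rewrite setYC; exact: rho_equiv.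
Qed.

Lemma nu_rho : [set nu A | A in rho @` S] = W.
Proof.
rewrite image_comp; apply: eq_imagel => A SA /=.
by have /densP[] := dens_rho SA.
Qed.

Lemma canon_rho_equiv X Y s : dens X s -> dens Y s ->
  (forall A, S A -> comparable X (canon A)) ->
  (forall A, S A -> comparable (rho A) Y) ->
  (forall e, 0 < e -> exists2 A, S A & `|nu A - s| <= e) ->
  null_sets R (X `+` Y).
Proof.
move=> dX dY cX cY lim; apply: null_symdiff_approx dX dY _ => e /lim[A SA As].
exists (canon A), (rho A), (nu A); split; [exact: cX|exact: cY| | |].
- apply: null_sets_subU (canon_equiv (SD SA)) (rho_equiv SA) => p.
  by rewrite /setY/=; have := EM (A p); tauto.
- by split; [exact: dens_canon (SD SA)|exact: dens_rho].
- by rewrite distrC.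
Qed.

Lemma bigcup_canon_rho : has_density R (\bigcup_(A in S) rho A) ->
  nu (\bigcup_(A in S) rho A) = sup01 W ->
  null_sets R ((\bigcup_(A in S) canon A) `+` (\bigcup_(A in S) rho A)).
Proof.
move=> hY nY; have [S0|/set0P S0] := eqVneq S set0.
  by rewrite S0 !bigcup_set0 /setY setDv setU0; exact: null_sets0.
apply: (@canon_rho_equiv _ _ (sup W)).
- rewrite -sup01_nonempty; first by case: bigcup_canon.
  by case: S0 => A SA; exists (nu A), A.
- apply/densP; split=> //; rewrite nY sup01_nonempty//.
  by case: S0 => A SA; exists (nu A), A.
- by move=> A SA; right; exact: (bigcup_sup (F := canon)).
- by move=> A SA; left; exact: (bigcup_sup (F := rho)).
- by move=> e; exact: sup_limit.
Qed.

Lemma bigcap_canon_rho : has_density R (\bigcap_(A in S) rho A) ->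
  nu (\bigcap_(A in S) rho A) = inf01 W ->
  null_sets R ((\bigcap_(A in S) canon A) `+` (\bigcap_(A in S) rho A)).
Proof.
move=> hY nY; have [S0|/set0P S0] := eqVneq S set0.
  by rewrite S0 !bigcap_set0 /setY setDv setU0; exact: null_sets0.
apply: (@canon_rho_equiv _ _ (inf W)).
- rewrite -inf01_nonempty; first by case: bigcap_canon.
  by case: S0 => A SA; exists (nu A), A.
- apply/densP; split=> //; rewrite nY inf01_nonempty//.
  by case: S0 => A SA; exists (nu A), A.
- by move=> A SA; left; exact: (bigcap_inf (F := canon)).
- by move=> A SA; right; exact: (bigcap_inf (F := rho)).
- by move=> e; exact: inf_limit.
Qed.

End Families.

End Layers.

Theorem theorem14 (R : realType) (T : set (set posnat))
    (chainT : chain T) (TF : T `<=` has_density R) :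
  let D := star T `&` has_density R in
  exists phi : {fun D >-> has_density R},
  (* 1 *)
  (forall A, D A -> null_sets R (phi A `+` A)) /\
  (* 2 *)
  (forall A B, D A -> D B ->
     (dclass R A = dclass R B <-> phi A = phi B) /\
     (dclass_lt R (dclass R A) (dclass R B) <-> phi A `<` phi B)) /\
  (* 3 *)
  (forall S : set (set posnat), S `<=` D ->
     (has_density R (\bigcup_(A in phi @` S) A) /\
      density R (\bigcup_(A in phi @` S) A)
        = sup01 [set density R A | A in phi @` S]) /\
     (has_density R (\bigcap_(A in phi @` S) A) /\
      density R (\bigcap_(A in phi @` S) A)
        = inf01 [set density R A | A in phi @` S])) /\
  (* 4 *)
  (forall A, star (phi @` D) A ->
     forall N : nat, (0 < N)%N -> nuN R A N <= density R A) /\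
  (* 5 *)
  (forall rho : {fun D >-> has_density R},
     (forall A, D A -> null_sets R (rho A `+` A)) ->
     forall S : set (set posnat), S `<=` D ->
     (has_density R (\bigcup_(A in rho @` S) A) /\
      density R (\bigcup_(A in rho @` S) A)
        = sup01 [set density R A | A in rho @` S] ->
      null_sets R ((\bigcup_(A in phi @` S) A) `+` (\bigcup_(A in rho @` S) A))) /\
     (has_density R (\bigcap_(A in rho @` S) A) /\
      density R (\bigcap_(A in rho @` S) A)
        = inf01 [set density R A | A in rho @` S] ->
      null_sets R ((\bigcap_(A in phi @` S) A) `+` (\bigcap_(A in rho @` S) A)))).
Proof.
move=> D.
have chainD : chain D.
  by move=> A B [sA _] [sB _]; exact: (chain_star chainT).
have DF : D `<=` has_density R by move=> A [].
pose f := canon R D.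
have fF : {homo f : A / D A >-> has_density R A}.
  by move=> A DA; have /densP[] := dens_canon chainD DF DA.
exists (mkfun_fun fF); rewrite /= -/f.
have nu_f S : S `<=` D -> [set density R A | A in f @` S] = density R @` S.
  move=> SD; apply: (nu_rho DF SD) => A /SD DA; exact: canon_equiv.
split; first by move=> A DA; exact: canon_equiv.
split.
  move=> A B DA DB; rewrite dclass_eqP; split; first exact: canon_eqP.
  exact: canon_properP.
split.
  move=> S SD; rewrite bigcup_image bigcap_image nu_f//; split; apply/densP.
    by case: (bigcup_canon chainD DF SD).
  by case: (bigcap_canon chainD DF SD).
split.
  move=> A sA n n0; rewrite nuN_le//.
  have sub C : C `<=` f @` D -> exists2 S, S `<=` D & C = f @` S.
    move=> CfD; exists (D `&` f @^-1` C); first by move=> B [].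
    apply/seteqP; split=> [B CB|_ [B [_ CfB] <-]//].
    by have [B' DB' B'B] := CfD B CB; exists B' => //; split; rewrite //= B'B.
  case: sA => -[C /sub[S SD ->] <-].
    rewrite bigcup_image; have [/densP[_ ->]] := bigcup_canon chainD DF SD.
    exact.
  rewrite bigcap_image; have [/densP[_ ->]] := bigcap_canon chainD DF SD.
  exact.
move=> rho rhoD S SD.
have rhoS A : S A -> null_sets R (rho A `+` A) by move=> /SD; exact: rhoD.
rewrite !bigcup_image !bigcap_image (nu_rho DF SD rhoS).
split=> -[hY nY]; first exact: bigcup_canon_rho.
exact: bigcap_canon_rho.
Qed.
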